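(* Let $L>0$, $\beta\in(0,1]$, $\alpha>0$ and $C\ge1$. There exists a constant $c_u'>0$, independent of $n,n_P,n_Q,\sigma^2$ (it may depend on $L,\beta,\alpha,C$), and, for every $\sigma\ge L$, an integer $n_u=n_u(\sigma,\beta,L,\alpha,C)$ such that for all nonnegative integers $n_P,n_Q$ with $\max\{n_P,n_Q\}\ge n_u$, and for every noise distribution admissible at level $\sigma$ in the observation model described in the context: (a) If $\alpha\ge1$, then for any $(P,Q)\in\mathcal{D}(\alpha,C)$, $$\inf_{\hat f}\sup_{f^\star\in\mathcal{F}(\beta,L)}\mathbf{E}\|\hat f-f^\star\|_{L^2(Q)}^2\ \le\ c_u'\Big\{\Big(\frac{n_P}{\sigma^2}\Big)^{\frac{2\beta+1}{2\beta+\alpha}}+\frac{n_Q}{\sigma^2}\Big\}^{-\frac{2\beta}{2\beta+1}}.$$ (b) If $\alpha\in(0,1]$, then for any $(P,Q)\in\mathcal{D}'(\alpha,C)$, $$\inf_{\hat f}\sup_{f^\star\in\mathcal{F}(\beta,L)}\mathbf{E}\|\hat f-f^\star\|_{L^2(Q)}^2\ \le\ c_u'\Big\{\Big(\frac{n_P}{\sigma^2}\Big)^{\frac{2\beta}{2\beta+\alpha}}+\frac{n_Q}{\sigma^2}\Big\}^{-1}.$$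
   Context: The covariate space is $\mathcal{X}=[0,1]$ with metric $|x-x'|$; $P,Q$ denote Borel probability measures on $[0,1]$; $\mathsf{B}(x,h)=\{x'\in[0,1]:|x-x'|\le h\}$. Similarity measure: $\rho_h(P,Q)=\int_{[0,1]}\frac{1}{P(\mathsf{B}(x,h))}\,dQ(x)$ for $h>0$ (with $1/0=+\infty$). For $\alpha\ge1$, $C\ge 1$: $\mathcal{D}(\alpha,C)=\{(P,Q):\ \sup_{0<h\le1}h^\alpha\rho_h(P,Q)\le C\}$. For $\alpha\in(0,1]$, $C\ge 1$: $\mathcal{D}'(\alpha,C)=\{(P,Q):\ \sup_{0<h\le1}h^\alpha\rho_h(P,Q)\le C\ \text{ and }\ \sup_{0<h\le1}\rho_h(Q,Q)\le C\}$. Function class: $\mathcal{F}(\beta,L)=\{f:[0,1]\to\mathbb{R}:\ |f(x)-f(x')|\le L|x-x'|^\beta\ \text{for all }x,x'\in[0,1],\ f(0)=0\}$. Observation model: $n=n_P+n_Q$; $(X_i,Y_i)_{i=1}^n$ are independent pairs with $X_1,\dots,X_{n_P}\sim P$, $X_{n_P+1},\dots,X_{n}\sim Q$, and $Y_i=f^\star(X_i)+\xi_i$, where the conditional law of $\xi_i$ given $X_i$ is the same for all $i$. The noise distribution is admissible at level $\sigma$ if $\mathbf{E}[\xi_i\mid X_i=x]=0$ and $\mathbf{E}[\xi_i^2\mid X_i=x]\le\sigma^2$ for all $x$. The infimum is over all estimators $\hat f$, i.e. measurable functions of the data $(X_i,Y_i)_{i=1}^n$ (which may depend on $P,Q,n_P,n_Q$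 and the parameters); the expectation is over the data, and $\|g\|_{L^2(Q)}^2=\int g^2\,dQ$. *)

(* Defs.v *)
From HB Require Import structures.
From mathcomp Require Import all_boot all_order all_algebra.
From mathcomp Require Import all_classical all_reals all_analysis.
Set Implicit Arguments.
Unset Strict Implicit.
Unset Printing Implicit Defensive.
Import Order.TTheory GRing.Theory Num.Theory.
Import numFieldNormedType.Exports.
Local Open Scope classical_set_scope.
Local Open Scope ring_scope.

Section Similarity.
Context {R : realType}.
Implicit Types P Q : probability (measurableTypeR R) R.

(* A Borel probability measure on [0, 1] is a Borel probability measure on R
   that gives full mass to [0, 1]. *)
Definition on_unit_interval P : Prop := P `[0, 1]%classic = 1%E.

Definition unit_ball (x h : R) : set R :=
  [set x' | x' \in `[0, 1] /\ `|x - x'| <= h].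

(* The inverse is the extended-real one, for which 0^-1 = +oo. *)
Definition rho (h : R) P Q : \bar R :=
  (\int[Q]_(x in `[0%R, 1%R]) (P (unit_ball x h))^-1)%E.

Definition classD (alpha C : R) P Q : Prop :=
  (ereal_sup [set (h `^ alpha)%:E * rho h P Q | h in `]0%R, 1%R]] <= C%:E)%E.

Definition classD' (alpha C : R) P Q : Prop :=
  classD alpha C P Q /\
  (ereal_sup [set rho h Q Q | h in `]0%R, 1%R]] <= C%:E)%E.

End Similarity.

(* A function on [0, 1] is represented by a function on R whose values outside
   [0, 1] are arbitrary and never used: covariates take values in [0, 1] and
   losses are integrated over [0, 1]. *)
Definition holder_class {R : realType} (beta L : R) : set (R -> R) :=
  [set f | (forall x x', x \in `[0, 1] -> x' \in `[0, 1] ->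
              `|f x - f x'| <= L * `|x - x'| `^ beta)
           /\ f 0 = 0].

(* Only the conditional laws given covariates in [0, 1] matter.  The bound on
   the second moment makes the identity integrable for K x. *)
Definition admissible_noise {R : realType} (sigma : R)
    (K : R.-pker (measurableTypeR R) ~> (measurableTypeR R)) : Prop :=
  forall x : R, x \in `[0, 1] ->
    (\int[K x]_y y%:E = 0)%E /\ (\int[K x]_y (y ^+ 2)%:E <= (sigma ^+ 2)%:E)%E.

Definition mutually_independent {R : realType} {d d' : measure_display}
    {Omega : measurableType d} {T : measurableType d'} {I : finType}
    (Pr : probability Omega R) (Z : I -> Omega -> T) : Prop :=
  forall (J : {set I}) (A : I -> set T), (forall i, measurable (A i)) ->
    (Pr (\bigcap_(i in [set` J]) (Z i @^-1` A i))
      = \prod_(i in J) Pr (Z i @^-1` A i))%E.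

Section Model.
Context {R : realType} {d : measure_display} {Omega : measurableType d}.
Variables (Pr : probability Omega R) (P Q : probability (measurableTypeR R) R).
Variables (nP nQ : nat).

Definition covariate_law (i : 'I_(nP + nQ)) :
    probability (measurableTypeR R) R :=
  if (i < nP)%N then P else Q.

(* The kernel K gives the conditional law of the noise given the covariate.
   Independence of the pairs (X i, xi i) amounts, for any regression function
   f, to that of the pairs (X i, f (X i) + xi i). *)
Record observation_model (K : R.-pker (measurableTypeR R) ~> (measurableTypeR R))
    (X xi : 'I_(nP + nQ) -> {RV Pr >-> measurableTypeR R}) : Prop := {
  covariate_unit : forall i w, X i w \in `[0, 1];
  covariate_distribution : forall i (A : set (measurableTypeR R)),
    measurable A -> distribution Pr (X i) A = covariate_law i A;
  noise_conditional_law : forall i (A B : set (measurableTypeR R)),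
    measurable A -> measurable B ->
    (Pr (X i @^-1` A `&` xi i @^-1` B) = \int[covariate_law i]_(x in A) K x B)%E;
  sample_independent :
    mutually_independent Pr (fun i w => (X i w, xi i w)) }.

Definition sample (X xi : 'I_(nP + nQ) -> {RV Pr >-> measurableTypeR R})
    (f : R -> R) (w : Omega) :
    (nP + nQ).-tuple (measurableTypeR R * measurableTypeR R)%type :=
  [tuple (X i w, f (X i w) + xi i w) | i < nP + nQ].

(* An estimator maps the data to a function of the covariate, measurably
   jointly in both arguments. *)
Definition estimator :
    set ((nP + nQ).-tuple (measurableTypeR R * measurableTypeR R)%type ->
         measurableTypeR R -> measurableTypeR R) :=
  [set fhat | measurable_fun setT (fun z => fhat z.1 z.2)].

Definition L2_norm_sq (g : R -> R) : \bar R :=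
  (\int[Q]_(x in `[0%R, 1%R]) (g x ^+ 2)%:E)%E.

Definition risk (X xi : 'I_(nP + nQ) -> {RV Pr >-> measurableTypeR R})
    (fhat : (nP + nQ).-tuple (measurableTypeR R * measurableTypeR R)%type ->
         measurableTypeR R -> measurableTypeR R) (f : R -> R) : \bar R :=
  (\int[Pr]_w L2_norm_sq (fun x => (fhat (sample X xi f w) x - f x)%R))%E.

Definition minimax_risk (beta L : R)
    (X xi : 'I_(nP + nQ) -> {RV Pr >-> measurableTypeR R}) : \bar R :=
  ereal_inf [set ereal_sup [set risk X xi fhat f | f in holder_class beta L]
            | fhat in estimator].

End Model.

(* Main.v *)
Require Import Defs.
From HB Require Import structures.
From mathcomp Require Import all_boot all_order all_algebra.
From mathcomp Require Import all_classical all_reals all_analysis.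
From mathcomp Require Import measurable_realfun ring lra.
Set Implicit Arguments.
Unset Strict Implicit.
Unset Printing Implicit Defensive.
Import Order.TTheory GRing.Theory Num.Theory.
Import numFieldNormedType.Exports.
Local Open Scope classical_set_scope.
Local Open Scope ring_scope.

(** An estimator may depend on P and Q, so the local average can be normalised
  by the expected number of covariates in the ball instead of the observed one.
  From n samples with common covariate law M, put
    fhat(x) = (sum_i Y_i 1{X_i in B(x, h)}) / (n M(B(x, h))).
  Independence bounds its mean squared error at x by
    L^2 h^(2 beta) + 9 sigma^2 / (n M(B(x, h))),
  and integrating against Q (Tonelli) gives
    L^2 h^(2 beta) + 9 sigma^2 rho_h(M, Q) / n.
  Use only the P-sample or only the Q-sample, whichever gives the dominant term
  of the rate, and choose h to balance both terms: rho_h(P, Q) <= C h^(-alpha) by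
  assumption, while rho_h(Q, Q) <= C in case (b) and rho_h(Q, Q) <= 2 / h always,
  by covering [0, 1] with at most 2 / h intervals of length h. Finally, n_u > sigma^2
  makes the dominant term at least 1, hence h <= 1. *)

(** * Integration against a mixture of kernels *)

Section Mixture.
Context d d' (X : measurableType d) (Y : measurableType d') (R : realType).
Variables (mu : {measure set X -> \bar R}) (D : set X) (K : R.-ker X ~> Y).
Variable nu : {measure set Y -> \bar R}.
Hypothesis mD : measurable D.
Hypothesis nuE : forall B, measurable B ->
  nu B = (\int[mu]_(x in D) K x B)%E.

Import HBNNSimple.

Let integral_mixture_nnsfun (g : {nnsfun Y >-> R}) :
  (\int[nu]_y (g y)%:E = \int[mu]_(x in D) \int[K x]_y (g y)%:E)%E.
Proof.
rewrite integralT_nnsfun sintegralE.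
under [RHS]eq_integral do rewrite integralT_nnsfun sintegralE.
have mg r : measurable (g @^-1` [set r]) by [].
have mK r : measurable_fun D (K ^~ (g @^-1` [set r])).
  by apply: measurable_funTS; exact: measurable_kernel.
rewrite ge0_integral_fsum//.
- apply: eq_fsbigr => r; rewrite inE => -[y _ <-].
  by rewrite ge0_integralZl ?lee_fin// nuE.
- by move=> r; exact: measurable_funeM.
(* For [r < 0] the level set of [g] is empty, so the term vanishes instead of being negative. *)
- by move=> r x _; exact: (mulemu_ge0 (fun r => g @^-1` [set r])
    (@preimage_nnfun0 _ _ g r)).
Qed.

(** Linearity gives the identity for nonnegative simple functions; the increasing approximations
    [g n] carry it to [f], by monotone convergence under [nu], under each [K x] and then under
    [mu]. *)
Lemma integral_mixture (f : Y -> \bar R) : (forall y, 0 <= f y)%E ->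
  measurable_fun setT f ->
  (\int[nu]_y f y = \int[mu]_(x in D) \int[K x]_y f y)%E.
Proof.
move=> f0 mf; pose g := nnsfun_approx measurableT mf.
have lim_g (m : {measure set Y -> \bar R}) :
    (\int[m]_y f y = limn (fun n => \int[m]_y (g n y)%:E))%E.
  rewrite -monotone_convergence//.
  - by apply: eq_integral => y _; apply/esym/cvg_lim => //; exact: cvg_nnsfun_approx.
  - by move=> n; exact/measurable_EFinP.
  - by move=> n y _; rewrite lee_fin.
  - by move=> y _ a b ab; rewrite lee_fin; exact/lefP/nd_nnsfun_approx.
rewrite lim_g; under [RHS]eq_integral do rewrite lim_g.
under eq_fun do rewrite integral_mixture_nnsfun.
rewrite monotone_convergence//.
- move=> n; apply: measurable_funTS; apply: measurable_fun_integral_kernel.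
  + exact: measurable_kernel.
  + by move=> y; rewrite lee_fin.
  + exact/measurable_EFinP.
- by move=> n x _; apply: integral_ge0 => y _; rewrite lee_fin.
- move=> x _ a b ab; apply: ge0_le_integral => //.
  + by move=> y _; rewrite lee_fin.
  + exact/measurable_EFinP.
  + exact/measurable_EFinP.
  + by move=> y _; rewrite lee_fin; exact/lefP/nd_nnsfun_approx.
Qed.

End Mixture.

(** * Expectation of a product of independent variables *)

Section IndependentProduct.
Context d (T : measurableType d) (R : realType) (Pr : probability T R).
Variables U V : T -> measurableTypeR R.
Hypothesis mU : measurable_fun setT U.
Hypothesis mV : measurable_fun setT V.
Hypothesis indUV : forall A B : set (measurableTypeR R),
  measurable A -> measurable B ->
  (Pr (U @^-1` A `&` V @^-1` B) = Pr (U @^-1` A) * Pr (V @^-1` B))%E.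

(** The joint law of [(U, V)] and the product of the marginal laws agree on rectangles, hence
    everywhere; Fubini then factors the integral. *)
Lemma integral_mul_independent :
  Pr.-integrable setT (EFin \o U) -> Pr.-integrable setT (EFin \o V) ->
  Pr.-integrable setT (fun w => (U w * V w)%:E) ->
  (\int[Pr]_w (U w * V w)%:E
    = (\int[Pr]_w (U w)%:E) * (\int[Pr]_w (V w)%:E))%E.
Proof.
move=> iU iV iUV.
pose U' : {mfun T >-> measurableTypeR R} :=
  HB.pack U (isMeasurableFun.Build _ _ _ _ _ mU).
pose V' : {mfun T >-> measurableTypeR R} :=
  HB.pack V (isMeasurableFun.Build _ _ _ _ _ mV).
pose Z : T -> measurableTypeR R * measurableTypeR R := fun w => (U w, V w).
have mZ : measurable_fun setT Z by exact: measurable_fun_pair.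
pose Z' : {mfun T >-> (measurableTypeR R * measurableTypeR R)%type} :=
  HB.pack Z (isMeasurableFun.Build _ _ _ _ _ mZ).
pose f : measurableTypeR R * measurableTypeR R -> \bar R :=
  fun z => (z.1 * z.2)%:E.
have mf : measurable_fun setT f.
  by apply/measurable_EFinP; apply: measurable_funM => //=.
have lawE := @product_measure_unique _ _ _ _ R (distribution Pr U')
  (distribution Pr V') (distribution Pr Z') indUV.
have -> : (\int[Pr]_w (U w * V w)%:E = \int[distribution Pr Z']_z f z)%E.
  by rewrite integral_distribution.
(* Fubini requires integrability under the product law; it is inherited from [iUV] because the two
   laws coincide. *)
have intf : (distribution Pr U' \x distribution Pr V')%E.-integrable setT f.
  apply/integrableP; split => //.
  rewrite (eq_measure_integral (distribution Pr Z')).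
    by have [] := integrableP _ _ _ (integrable_pushforward mZ mf iUV measurableT).
  by move=> A mA _; exact: lawE.
rewrite (eq_measure_integral (distribution Pr U' \x distribution Pr V')%E); last first.
  by move=> A mA _; exact/esym/lawE.
rewrite -integral12_prod_meas1// /fubini_F /f /=.
have eV : (\int[Pr]_w (V w)%:E = \int[distribution Pr V']_y y%:E)%E.
  by rewrite integral_distribution//; exact/measurable_EFinP.
have eU : (\int[Pr]_w (U w)%:E = \int[distribution Pr U']_y y%:E)%E.
  by rewrite integral_distribution//; exact/measurable_EFinP.
have iV' : (distribution Pr V').-integrable setT EFin.
  by apply: integrable_pushforward => //; exact/measurable_EFinP.
have iU' : (distribution Pr U').-integrable setT EFin.
  by apply: integrable_pushforward => //; exact/measurable_EFinP.
under eq_integral do under eq_integral do rewrite EFinM.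
under eq_integral do rewrite integralZl//.
rewrite eV eU.
have fV : (\int[distribution Pr V']_y y%:E)%E \is a fin_num.
  exact: integrable_fin_num.
by rewrite -(fineK fV) integralZr.
Qed.

End IndependentProduct.

(** * Moments of one summand of the local average *)

Section LocalResponse.
Context d (Omega : measurableType d) (R : realType) (Pr : probability Omega R).
Variables (M : probability (measurableTypeR R) R).
Variables (K : R.-pker (measurableTypeR R) ~> (measurableTypeR R)).
Variables (X xi : {RV Pr >-> measurableTypeR R}).
Variable A : set (measurableTypeR R).
Hypothesis mA : measurable A.
Hypothesis XE : Pr (X @^-1` A) = M A.
Hypothesis xiE : forall B : set (measurableTypeR R), measurable B ->
  (Pr (X @^-1` A `&` xi @^-1` B) = \int[M]_(x in A) K x B)%E.

Let mXA : measurable (X @^-1` A).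
Proof. by rewrite -[X in measurable X]setTI; exact: measurable_funPT. Qed.

Lemma integral_noise (f : R -> \bar R) : (forall y, 0 <= f y)%E ->
  measurable_fun [set: measurableTypeR R] f ->
  (\int[Pr]_(w in X @^-1` A) f (xi w)
    = \int[M]_(x in A) \int[K x]_y f y)%E.
Proof.
move=> f0 mf.
have mxi : measurable_fun setT xi by exact: measurable_funPT.
(* nu, the law of xi on the event X \in A, is a mixture of the K x by hypothesis
   and of the Dirac measures at xi w trivially. *)
pose nu := pushforward (mrestr Pr mXA) xi
  : {measure set (measurableTypeR R) -> \bar R}.
rewrite -(@integral_mixture _ _ _ _ _ M A K (nu mxi))//; last first.
  by move=> B mB; rewrite -xiE// setIC.
pose D : R.-ker Omega ~> measurableTypeR R := @kdirac _ _ _ _ R _ mxi.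
rewrite (@integral_mixture _ _ _ _ _ Pr (X @^-1` A) D (nu mxi))//; last first.
  move=> B mB; transitivity (Pr (xi @^-1` B `&` X @^-1` A)) => //.
  rewrite -integral_indic//.
  by rewrite -[X in measurable X]setTI; exact: measurable_funPT.
by apply: eq_integral => w _; rewrite integral_dirac// diracT mul1e.
Qed.

Variable sigma : R.
Hypothesis KA : forall x, A x ->
  (\int[K x]_y y%:E = 0)%E /\ (\int[K x]_y (y ^+ 2)%:E <= (sigma ^+ 2)%:E)%E.

Let p := fine (M A).

Let pE : p%:E = M A.
Proof. by rewrite fineK// fin_num_measure. Qed.

Let mK (f : R -> \bar R) : (forall y, 0 <= f y)%E ->
  measurable_fun [set: measurableTypeR R] f ->
  measurable_fun A (fun x => \int[K x]_y f y)%E.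
Proof.
move=> f0 mf; apply: measurable_funTS; apply: measurable_fun_integral_kernel => //.
exact: measurable_kernel.
Qed.

Lemma integral_noise_sqr :
  (\int[Pr]_(w in X @^-1` A) (xi w ^+ 2)%:E <= (sigma ^+ 2 * p)%:E)%E.
Proof.
rewrite (integral_noise (f := fun y => (y ^+ 2)%:E)); last 2 first.
  by move=> y; rewrite lee_fin sqr_ge0.
  by apply/measurable_EFinP; exact: measurable_funX.
rewrite EFinM pE -integral_cst//; apply: ge0_le_integral => //.
- by move=> x _; apply: integral_ge0 => y _; rewrite lee_fin sqr_ge0.
- apply: mK => [y|]; first by rewrite lee_fin sqr_ge0.
  by apply/measurable_EFinP; exact: measurable_funX.
- by move=> x /KA[].
Qed.

Lemma integrable_noise : Pr.-integrable (X @^-1` A) (EFin \o xi).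
Proof.
have mxi : measurable_fun (X @^-1` A) xi.
  by apply: measurable_funTS; exact: measurable_funPT.
(* As [|y| <= y ^+ 2 + 1] and [Pr] is finite, the second moment controls the first. *)
apply: (@le_integrable _ _ _ _ _ mXA _ (EFin \o (fun w => xi w ^+ 2 + 1))).
- exact/measurable_EFinP.
- move=> w _ /=; rewrite lee_fin [leRHS]ger0_norm; last by nra.
  by rewrite ler_norml; apply/andP; split; nra.
- apply: (@integrableD _ _ _ _ _ mXA (EFin \o (fun w => xi w ^+ 2)) (cst 1%E)).
    apply/integrableP; split; first by apply/measurable_EFinP; exact: measurable_funX.
    under eq_integral do rewrite /= ger0_norm ?sqr_ge0//.
    by rewrite (le_lt_trans integral_noise_sqr)// ltry.
  exact: finite_measure_integrable_cst.
Qed.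

Lemma integral_noise_eq0 : (\int[Pr]_(w in X @^-1` A) (xi w)%:E = 0)%E.
Proof.
have ixi := integrable_noise.
have mid : measurable_fun [set: measurableTypeR R] (EFin : R -> \bar R).
  exact/measurable_EFinP.
(* [integral_noise] covers only nonnegative integrands, so the positive and negative parts of [xi]
   are transferred separately. *)
have posE : (\int[Pr]_(w in X @^-1` A) ((EFin \o xi)^\+ w)
    = \int[M]_(x in A) \int[K x]_y (EFin^\+ y))%E.
  rewrite -(integral_noise (f := (EFin : R -> \bar R)^\+%E))//; last first.
    exact: measurable_funepos.
  by apply: eq_integral => w _; rewrite !funeposE.
have negE : (\int[Pr]_(w in X @^-1` A) ((EFin \o xi)^\- w)
    = \int[M]_(x in A) \int[K x]_y (EFin^\- y))%E.
  rewrite -(integral_noise (f := (EFin : R -> \bar R)^\-%E))//; last first.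
    exact: measurable_funeneg.
  by apply: eq_integral => w _; rewrite !funenegE.
(* In \bar R, r - s = 0 with r, s >= 0 forces r = s, even without finiteness. *)
have pos_neg : (\int[Pr]_(w in X @^-1` A) ((EFin \o xi)^\+ w)
    = \int[Pr]_(w in X @^-1` A) ((EFin \o xi)^\- w))%E.
  rewrite posE negE; apply: eq_integral => x /[!inE] /KA[+ _].
  rewrite integralE.
  have : (0 <= \int[K x]_y EFin^\+ y)%E by exact: integral_ge0.
  have : (0 <= \int[K x]_y EFin^\- y)%E by exact: integral_ge0.
  case: (\int[K x]_y EFin^\- y)%E => [s| |]; case: (\int[K x]_y EFin^\+ y)%E => [r| |]//=.
  by move=> _ _ /eqP; rewrite -EFinB eqe subr_eq0 => /eqP ->.
rewrite (integralE _ _ (fun w => (xi w)%:E)) -/(EFin \o xi) pos_neg subee//.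
exact: integrable_neg_fin_num.
Qed.

Variables (g : R -> R) (c b : R).
Hypothesis mg : measurable_fun [set: measurableTypeR R] g.
Hypothesis gA : forall y, A y -> `|g y| <= sigma.
Hypothesis gcA : forall y, A y -> `|g y - c| <= b.
Hypothesis c_le : `|c| <= sigma.

(* With c = f x, these terms sum to n p (fhat x - f x) over a sample of size n. *)
Definition local_response (w : Omega) : R :=
  (g (X w) + xi w) * \1_A (X w) - c * p.

Let p_ge0 : 0 <= p. Proof. by rewrite fine_ge0. Qed.
Let p_le1 : p <= 1.
Proof. by rewrite -lee_fin pE probability_le1. Qed.

Let mX : measurable_fun [set: Omega] X. Proof. exact: measurable_funPT. Qed.
Let mxi : measurable_fun [set: Omega] xi. Proof. exact: measurable_funPT. Qed.

Let m1 : measurable_fun [set: Omega] (fun w => \1_A (X w) : R).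
Proof. by apply: (measurableT_comp (f := \1_A : _ -> R)). Qed.

Lemma measurable_local_response : measurable_fun [set: Omega] local_response.
Proof.
apply: measurable_funB => //; apply: measurable_funM => //.
by apply: measurable_funD => //; apply: (measurableT_comp mg).
Qed.

Let int1 : (\int[Pr]_w (\1_A (X w))%:E = p%:E)%E.
Proof.
rewrite pE -XE -[in RHS](setIT (X @^-1` A)) -integral_indic//.
Qed.

Let i1 : Pr.-integrable setT (fun w => (\1_A (X w))%:E).
Proof. exact: (integrable_indic Pr mXA). Qed.

Let patchE (f : Omega -> R) :
  (fun w => (f w * \1_A (X w))%:E) = ((EFin \o f) \_ (X @^-1` A))%E.
Proof.
apply/funext => w; rewrite patchE indicE.
by rewrite (_ : (w \in X @^-1` A) = (X w \in A))//; case: ifP => _;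
  rewrite ?mulr1 ?mulr0.
Qed.

(** The three terms [g], [xi] and [c * p] contribute at most [3 * sigma ^+ 2 * p] each, whence the
    9; for the last one, [p <= 1] gives [(c * p) ^+ 2 <= sigma ^+ 2 * p]. *)
Lemma integral_local_response_sqr :
  (\int[Pr]_w (local_response w ^+ 2)%:E <= (9 * sigma ^+ 2 * p)%:E)%E.
Proof.
have sigma_ge0 : 0 <= sigma by exact: le_trans (normr_ge0 _) c_le.
have c2 : c ^+ 2 <= sigma ^+ 2.
  by rewrite -real_normK ?num_real// lerXn2r ?nnegrE.
pose S w := (3 * sigma ^+ 2) * \1_A (X w) + 3 * (xi w ^+ 2 * \1_A (X w))
  + 3 * sigma ^+ 2 * p.
have mS : measurable_fun [set: Omega] (fun w => xi w ^+ 2 * \1_A (X w)).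
  by apply: measurable_funM => //; exact: measurable_funX.
apply: (@le_trans _ _ (\int[Pr]_w (S w)%:E)%E).
  apply: ge0_le_integral => //.
  - by move=> w _; rewrite lee_fin sqr_ge0.
  - by apply/measurable_EFinP; apply: measurable_funX;
      exact: measurable_local_response.
  - apply/measurable_EFinP; apply: measurable_funD => //.
    by apply: measurable_funD; apply: measurable_funM.
  - have cp2 : (c * p) ^+ 2 <= sigma ^+ 2 * p.
      rewrite exprMn; apply: ler_pM => //; rewrite ?sqr_ge0//.
      by rewrite expr2 ler_piMl.
    have sp : 0 <= sigma ^+ 2 * p by rewrite mulr_ge0 ?sqr_ge0.
    move=> w _; rewrite lee_fin /S /local_response indicE.
    case: (boolP (X w \in A)) => [/[!inE] /gA gw|_] /=; last first.
      by rewrite !mulr0 !add0r sqrrN; lra.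
    have g2 : g (X w) ^+ 2 <= sigma ^+ 2.
      by rewrite -real_normK ?num_real// lerXn2r ?nnegrE.
    (* The difference of the two sides is [(x - y) ^+ 2 + (x + z) ^+ 2 + (y + z) ^+ 2]. *)
    have sq3 (x y z : R) :
        (x + y - z) ^+ 2 <= 3 * x ^+ 2 + 3 * y ^+ 2 + 3 * z ^+ 2.
      have := sqr_ge0 (x - y); have := sqr_ge0 (x + z).
      by have := sqr_ge0 (y + z); nra.
    by have := sq3 (g (X w)) (xi w) (c * p); rewrite !mulr1; lra.
have s2 : 0 <= sigma ^+ 2 by exact: sqr_ge0.
have nS w : 0 <= xi w ^+ 2 * \1_A (X w) by rewrite mulr_ge0 ?sqr_ge0.
pose S1 w : \bar R := ((3 * sigma ^+ 2)%:E * (\1_A (X w))%:E)%E.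
pose S2 w : \bar R := (3%:E * (xi w ^+ 2 * \1_A (X w))%:E)%E.
have S1_ge0 w : (0 <= S1 w)%E by rewrite /S1 -EFinM lee_fin !mulr_ge0.
have S2_ge0 w : (0 <= S2 w)%E by rewrite /S2 -EFinM lee_fin mulr_ge0.
have mS1 : measurable_fun setT S1.
  by apply: measurable_funeM; exact/measurable_EFinP.
have mS2 : measurable_fun setT S2.
  by apply: measurable_funeM; exact/measurable_EFinP.
have -> : (fun w => (S w)%:E) = (fun w => S1 w + S2 w + (3 * sigma ^+ 2 * p)%:E)%E.
  by apply/funext => w; rewrite /S !EFinD !EFinM.
rewrite ge0_integralD//; last 3 first.
- by move=> w _; rewrite adde_ge0.
- exact: emeasurable_funD.
- by move=> w _; rewrite lee_fin !mulr_ge0.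
rewrite ge0_integralD// integral_cst//= probability_setT mule1.
rewrite ge0_integralZl//; last 2 first.
- exact/measurable_EFinP.
- by rewrite lee_fin mulr_ge0.
rewrite int1 ge0_integralZl//; last 2 first.
- exact/measurable_EFinP.
- by move=> w _; rewrite lee_fin.
rewrite (patchE (fun w => xi w ^+ 2)) -integral_mkcond.
apply: (@le_trans _ _ ((3 * sigma ^+ 2)%:E * p%:E + 3%:E * (sigma ^+ 2 * p)%:E
  + (3 * sigma ^+ 2 * p)%:E))%E; last first.
  by rewrite -!EFinM -!EFinD lee_fin; nra.
by rewrite leeD2r// leeD2l// lee_pmul2l// integral_noise_sqr.
Qed.

(** The noise has mean zero on the event and [c * \1_A (X w)] has mean [c * p], which cancels the
    centring; only the bias [g - c], at most [b] on [A], survives. The existential form records that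
    the integral is finite. *)
Lemma integral_local_response :
  exists2 m, (\int[Pr]_w (local_response w)%:E = m%:E)%E & `|m| <= b * p.
Proof.
pose a1 w := (g (X w) - c) * \1_A (X w).
pose a2 w := xi w * \1_A (X w).
have ma1 : measurable_fun [set: Omega] a1.
  apply: measurable_funM => //; apply: measurable_funB => //.
  exact: (measurableT_comp mg).
have a1_le w : `|a1 w| <= b * \1_A (X w).
  rewrite /a1 indicE; case: (boolP (X w \in A)) => [/[!inE] /gcA gw|_] /=.
    by rewrite !mulr1.
  by rewrite !mulr0 normr0.
have ib : Pr.-integrable setT (fun w => (b * \1_A (X w))%:E).
  exact: (integrableZl measurableT b i1).
have ia1 : Pr.-integrable setT (EFin \o a1).
  apply: (le_integrable measurableT) ib => //.
    exact/measurable_EFinP.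
  by move=> w _ /=; rewrite lee_fin (le_trans (a1_le w))// ler_norm.
have ia2 : Pr.-integrable setT (EFin \o a2).
  rewrite /comp /a2 patchE; apply/(integrable_mkcond _ mXA).
  exact: integrable_noise.
have ia3 : Pr.-integrable setT (fun w => (c * \1_A (X w))%:E).
  exact: (integrableZl measurableT c i1).
have icp : Pr.-integrable setT (EFin \o cst (- (c * p))).
  exact: finite_measure_integrable_cst.
have ia12 : Pr.-integrable setT (EFin \o (a1 \+ a2)).
  exact: (integrableD measurableT ia1 ia2).
have ia123 : Pr.-integrable setT (EFin \o (a1 \+ a2 \+ (fun w => c * \1_A (X w)))).
  exact: (integrableD measurableT ia12 ia3).
have -> : (\int[Pr]_w (local_response w)%:E = \int[Pr]_w (a1 w)%:E)%E.
  have -> : (fun w => (local_response w)%:E) =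
      (fun w => ((a1 \+ a2 \+ (fun w => c * \1_A (X w))) w + cst (- (c * p)) w)%:E).
    by apply/funext => w; rewrite /local_response /a1 /a2 /=; congr EFin; ring.
  have E3 : (\int[Pr]_w (EFin \o (fun w => c * \1_A (X w))%R) w = (c * p)%:E)%E.
    rewrite /comp; under eq_integral do rewrite EFinM.
    by rewrite integralZl// int1.
  have E2 : (\int[Pr]_w (EFin \o a2) w = 0)%E.
    by rewrite /comp (patchE xi) -integral_mkcond integral_noise_eq0.
  have E4 : (\int[Pr]_w (EFin \o cst (- (c * p))%R) w = (- (c * p))%:E)%E.
    rewrite (integral_cst Pr measurableT (- (c * p))%:E).
    by have /= -> := probability_setT Pr; rewrite mule1.
  rewrite integralD_EFin// integralD_EFin// integralD_EFin//.
  by rewrite E2 E3 E4 adde0 -addeA -EFinD subrr adde0.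
have fa1 : (\int[Pr]_w (a1 w)%:E)%E \is a fin_num by exact: integrable_fin_num.
exists (fine (\int[Pr]_w (a1 w)%:E)%E); first by rewrite fineK.
rewrite -lee_fin -abse_EFin fineK//.
apply: (le_trans (le_abse_integral _ _ _)) => //; first exact/measurable_EFinP.
apply: (@le_trans _ _ (\int[Pr]_w (b * \1_A (X w))%:E)%E).
  apply: ge0_le_integral => //.
  - by apply/measurable_EFinP; exact: measurableT_comp.
  - by apply/measurable_EFinP; apply: measurable_funM.
  - by move=> w _; rewrite /= lee_fin.
under eq_integral do rewrite EFinM.
by rewrite integralZl// int1 -EFinM lexx.
Qed.

End LocalResponse.

(** * Second moment of a sum of pairwise independent variables *)

Section SecondMoment.
Context d (Omega : measurableType d) (R : realType) (Pr : probability Omega R).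
Variables (n : nat) (V : 'I_n -> Omega -> measurableTypeR R) (m s : R).
Hypothesis mV : forall i, measurable_fun [set: Omega] (V i).
Hypothesis mean_le : forall i,
  exists2 mi, (\int[Pr]_w (V i w)%:E = mi%:E)%E & `|mi| <= m.
Hypothesis sqr_le : forall i, (\int[Pr]_w (V i w ^+ 2)%:E <= s%:E)%E.
Hypothesis indep : forall i j, i != j -> forall A B : set (measurableTypeR R),
  measurable A -> measurable B ->
  (Pr (V i @^-1` A `&` V j @^-1` B) = Pr (V i @^-1` A) * Pr (V j @^-1` B))%E.

Let iV2 i : Pr.-integrable setT (EFin \o (fun w => V i w ^+ 2)).
Proof.
apply/integrableP; split; first by apply/measurable_EFinP; exact: (measurable_funX 2 (mV i)).
under eq_integral do rewrite /= ger0_norm ?sqr_ge0//.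
by rewrite (le_lt_trans (sqr_le i))// ltry.
Qed.

Let iV i : Pr.-integrable setT (EFin \o V i).
Proof.
apply: (@le_integrable _ _ _ _ _ measurableT _
  (EFin \o (fun w => V i w ^+ 2)%R \+ cst 1)%E).
- exact/measurable_EFinP/mV.
- move=> w _ /=; rewrite lee_fin [leRHS]ger0_norm; last by nra.
  by rewrite ler_norml; apply/andP; split; nra.
- apply: (integrableD measurableT (iV2 i)).
  exact: (finite_measure_integrable_cst Pr 1 measurableT).
Qed.

Let iVV i j : Pr.-integrable setT (fun w => (V i w * V j w)%:E).
Proof.
apply: (@le_integrable _ _ _ _ _ measurableT _
  ((EFin \o (fun w => V i w ^+ 2)%R) \+ (EFin \o (fun w => V j w ^+ 2)%R))%E).
- by apply/measurable_EFinP; exact: (measurable_funM (mV i) (mV j)).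
- move=> w _ /=; rewrite lee_fin [leRHS]ger0_norm; last by nra.
  by rewrite ler_norml; apply/andP; split;
    have := sqr_ge0 (V i w + V j w); have := sqr_ge0 (V i w - V j w); nra.
- exact: (integrableD measurableT (iV2 i) (iV2 j)).
Qed.

(** In the expanded square, a diagonal term is at most [s] and, by independence, an off-diagonal one
    is a product of two means, at most [m ^+ 2]. *)
Lemma integral_sum_sqr_le :
  (\int[Pr]_w ((\sum_i V i w) ^+ 2)%:E <= ((n%:R * m) ^+ 2 + n%:R * s)%:E)%E.
Proof.
have -> : (fun w => ((\sum_i V i w) ^+ 2)%:E)
    = (fun w => \sum_i \sum_j (V i w * V j w)%:E)%E.
  apply/funext => w; rewrite expr2 big_distrlr/= -sumEFin.
  by apply: eq_bigr => i _; rewrite -sumEFin.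
rewrite integral_sum//; last by move=> i; exact: integrable_sum.
(* Granting [m ^+ 2] to the diagonal terms as well makes the total exactly the claimed bound. *)
have -> : ((n%:R * m) ^+ 2 + n%:R * s)%:E
    = (\sum_(i < n) \sum_(j < n) (m ^+ 2 + (i == j)%:R * s)%:E)%E.
  under eq_bigr do rewrite sumEFin.
  rewrite sumEFin; congr EFin.
  under [RHS]eq_bigr => i _.
    rewrite big_split/= sumr_const card_ord -mulr_suml.
    rewrite (bigD1 i)//= eqxx big1 ?addr0 ?mul1r; last first.
      by move=> j /negbTE ji; rewrite eq_sym ji.
    over.
  rewrite sumr_const card_ord -(mulr_natl (_ + s)) -(mulr_natl (m ^+ 2)).
  by rewrite exprMn; ring.
apply: lee_sum => i _; rewrite integral_sum//; apply: lee_sum => j _.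
have [<-|ij] := eqVneq i j.
  under eq_integral do rewrite -expr2.
  rewrite mul1r (le_trans (sqr_le i))// lee_fin.
  by have := sqr_ge0 m; lra.
rewrite mul0r addr0 (integral_mul_independent (mV i) (mV j) (indep ij))//.
have [a -> am] := mean_le i; have [b -> bm] := mean_le j.
rewrite -EFinM lee_fin (le_trans (ler_norm _))// normrM expr2.
by rewrite ler_pM.
Qed.

End SecondMoment.

Lemma mutually_independent_pair {R : realType} d d' (Omega : measurableType d)
    (T : measurableType d') (I : finType) (Pr : probability Omega R)
    (Z : I -> Omega -> T) (i j : I) (A B : set T) :
  mutually_independent Pr Z -> i != j -> measurable A -> measurable B ->
  (Pr (Z i @^-1` A `&` Z j @^-1` B) = Pr (Z i @^-1` A) * Pr (Z j @^-1` B))%E.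
Proof.
(* Only the values of [C] at [i] and [j] enter the product over the index set {i, j}; [i != j] makes
   them [A] and [B]. *)
move=> indZ ij mA mB; pose C k := if k == i then A else B.
have /(indZ [set i; j]%SET) : forall k, measurable (C k).
  by move=> k; rewrite /C; case: ifP.
rewrite big_setU1 ?inE//= big_set1 /C eqxx eq_sym (negbTE ij) => <-.
congr (Pr _); apply/seteqP; split => w /=.
  move=> [ZA ZB] k /=; rewrite !inE => /orP[] /eqP ->; rewrite /C ?eqxx//.
  by rewrite eq_sym (negbTE ij).
move=> ZC; split.
  by have := ZC i; rewrite /C eqxx; apply; rewrite /= !inE eqxx.
by have := ZC j; rewrite /C eq_sym (negbTE ij); apply; rewrite /= !inE eqxx orbT.
Qed.

(** * Measurability of balls and of their masses *)

Section UnitBall.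
Context (R : realType).
Implicit Types (M : probability (measurableTypeR R) R) (x y h : R).

(** All balls of radius [h] are sections of this one measurable set in the plane, so their masses
    depend measurably on the centre. *)
Let ball_graph h : set (measurableTypeR R * measurableTypeR R) :=
  [set z | z.2 \in `[0, 1] /\ `|z.1 - z.2| <= h].

Let measurable_ball_graph h : measurable (ball_graph h).
Proof.
have -> : ball_graph h = (snd @^-1` `[0%R, 1%R]%classic) `&`
    [set z : measurableTypeR R * measurableTypeR R | `|z.1 - z.2| <= h].
  by apply/seteqP; split.
apply: measurable_fun_le => //.
  rewrite -[X in measurable X]setTI; apply: (measurable_snd measurableT).
  exact: measurable_itv.
apply: measurable_funTS; apply: (measurableT_comp (@normr_measurable R setT)).
exact: measurable_funB.
Qed.

Let xsection_ball_graph h x : xsection (ball_graph h) x = unit_ball x h.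
Proof. by apply/seteqP; split => y; rewrite /xsection /= inE. Qed.

Lemma measurable_unit_ball x h :
  measurable (unit_ball x h : set (measurableTypeR R)).
Proof. by rewrite -xsection_ball_graph; exact: measurable_xsection. Qed.

Lemma measurable_indic_unit_ball d (T : measurableType d) h
    (u v : T -> measurableTypeR R) :
  measurable_fun setT u -> measurable_fun setT v ->
  measurable_fun setT (fun t => \1_(unit_ball (u t) h) (v t) : R).
Proof.
move=> mu mv.
have -> : (fun t => \1_(unit_ball (u t) h) (v t) : R) =
    \1_(ball_graph h) \o (fun t => (u t, v t)).
  apply/funext => t; rewrite /= !indicE /=.
  have -> // : (v t \in unit_ball (u t) h) = ((u t, v t) \in ball_graph h).
  by apply/idP/idP; rewrite !inE.
apply: measurableT_comp; first exact: measurable_indic.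
exact: measurable_fun_pair.
Qed.

Lemma measurable_measure_unit_ball M h : measurable_fun setT
  (fun x : measurableTypeR R => fine (M (unit_ball x h))).
Proof.
apply/measurable_EFinP.
rewrite (_ : _ \o _ = M \o xsection (ball_graph h)).
  exact: measurable_fun_xsection.
apply/funext => x /=; rewrite xsection_ball_graph fineK// fin_num_measure//.
exact: measurable_unit_ball.
Qed.

(** Reading the inverse as a power with exponent [-1] is valid at 0 too, where both are 0. *)
Lemma measurable_inv_normr : measurable_fun setT (fun x : R => `|x|^-1).
Proof.
have -> : (fun x : R => `|x|^-1) = (fun x => `|x| `^ (- 1)).
  by apply/funext => x; rewrite powR_inv1.
by apply: (measurableT_comp (measurable_powR (-1))).
Qed.

Lemma measurable_inve_measure_unit_ball M h : measurable_fun setT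
  (fun x : measurableTypeR R => (M (unit_ball x h))^-1)%E.
Proof.
pose p (x : measurableTypeR R) := fine (M (unit_ball x h)).
have -> : (fun x : measurableTypeR R => (M (unit_ball x h))^-1)%E =
    (fun x => if p x == 0 then +oo%E else (`|p x|^-1)%:E).
  apply/funext => x; rewrite -[in LHS](@fineK _ (M (unit_ball x h))).
    by rewrite inver -/(p x) ger0_norm// fine_ge0.
  by rewrite fin_num_measure//; exact: measurable_unit_ball.
have mp := measurable_measure_unit_ball M h.
apply: measurable_fun_ifT => //; first exact: measurable_fun_eqr.
apply/measurable_EFinP.
exact: (measurableT_comp measurable_inv_normr).
Qed.

End UnitBall.

(** The Hölder condition makes [f] continuous on the subspace [0, 1], hence measurable there. Its
    values elsewhere are arbitrary, so it is extended by 0. *)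
Lemma measurable_holder {R : realType} (beta L : R) (f : R -> R) :
  0 < beta -> 0 < L -> holder_class beta L f ->
  measurable_fun [set: measurableTypeR R] (f \_ `[0, 1]%classic).
Proof.
move=> b0 L0 [fL _].
have mI := measurable_itv `[0%R, 1%R]
  : measurable (_ : set (measurableTypeR R)).
apply/(measurable_restrictT (f : measurableTypeR R -> R) mI).
apply: subspace_continuous_measurable_fun; first exact: measurable_itv.
apply/subspace_continuousP => x x01; apply/cvgrPdist_lt => eps eps0.
(* [delta] solves L delta^beta = eps. *)
pose delta := (eps / L) `^ beta^-1.
have delta0 : 0 < delta by apply: powR_gt0; apply: divr_gt0.
rewrite near_withinE; near=> y => y01.
rewrite (le_lt_trans (fL x y _ _))//.
rewrite -ltr_pdivlMl// mulrC.
have -> : eps / L = delta `^ beta.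
  by rewrite -powRrM mulVf ?gt_eqF// powRr1// ltW// divr_gt0.
apply: gt0_ltr_powR => //; rewrite ?nnegrE ?normr_ge0 ?(ltW delta0)//.
Unshelve. all: by end_near. Qed.

(** * Risk of the local average over one sample *)

Section SubsampleRisk.
Context (R : realType) (beta L sigma : R).
Hypothesis beta_gt0 : 0 < beta.
Hypothesis L_gt0 : 0 < L.
Hypothesis L_le : L <= sigma.
Context (d : measure_display) (Omega : measurableType d).
Variables (Pr : probability Omega R) (P Q : probability (measurableTypeR R) R).
Variables (nP nQ : nat).
Variable K : R.-pker (measurableTypeR R) ~> (measurableTypeR R).
Hypothesis K_adm : admissible_noise sigma K.
Variables X xi : 'I_(nP + nQ) -> {RV Pr >-> measurableTypeR R}.
Hypothesis model : observation_model P Q K X xi.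
Variables (n : nat) (e : 'I_n -> 'I_(nP + nQ)).
Variable M : probability (measurableTypeR R) R.
Hypothesis n_gt0 : (0 < n)%N.
Hypothesis e_inj : injective e.
Hypothesis law_e : forall i, covariate_law P Q (e i) = M.
Variable h : R.
Hypothesis h_gt0 : 0 < h.

Let p (x : R) : R := fine (M (unit_ball x h)).

(* The norm is harmless, p being nonnegative; where p x = 0 the estimate is 0,
   as 0^-1 = 0. *)
Definition local_average
    (z : (nP + nQ).-tuple (measurableTypeR R * measurableTypeR R)%type)
    (x : measurableTypeR R) : measurableTypeR R :=
  (\sum_(i < n) (tnth z (e i)).2 * \1_(unit_ball x h) (tnth z (e i)).1)
    * `|n%:R * p x|^-1.

Lemma local_average_estimator : estimator local_average.
Proof.
apply: measurable_funM; last first.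
  apply: (measurableT_comp (@measurable_inv_normr R)); apply: measurable_funM => //.
  by apply: (measurableT_comp (measurable_measure_unit_ball M h)).
apply: measurable_sum => i.
have mz : measurable_fun setT
    (fun z : (nP + nQ).-tuple (measurableTypeR R * measurableTypeR R)
       * measurableTypeR R => tnth z.1 (e i)).
  by apply: (measurableT_comp (measurable_tnth (e i))).
apply: measurable_funM; first exact: (measurableT_comp measurable_snd mz).
apply: measurable_indic_unit_ball => //.
exact: (measurableT_comp measurable_fst mz).
Qed.

Variable f : R -> R.
Hypothesis f_holder : holder_class beta L f.

(** [f] may fail to be measurable off [0, 1]; [g] is measurable on the whole line and agrees with
    [f] wherever covariates live. *)
Let g : R -> R := f \_ `[0, 1]%classic.

Let mg : measurable_fun [set: measurableTypeR R] g.
Proof. exact: measurable_holder f_holder. Qed.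

Let gE x : x \in `[0, 1] -> g x = f x.
Proof. by move=> x01; rewrite /g patchE mem_set. Qed.

Let sigma_gt0 : 0 < sigma. Proof. exact: lt_le_trans L_le. Qed.

(** Since [f 0 = 0], |f(x)| is at most L x^beta, hence at most [L]; then [L <= sigma] lets the noise
    level bound the signal as well. *)
Let f_le x : x \in `[0, 1] -> `|f x| <= sigma.
Proof.
move=> x01; have [fL f0] := f_holder.
have := fL x 0 x01; rewrite in_itv/= lexx ler01 => /(_ isT).
rewrite f0 !subr0 => /le_trans; apply; apply: le_trans L_le.
rewrite ler_piMr ?(ltW L_gt0)//.
move: x01; rewrite in_itv/= => /andP[x0 x1].
have : x `^ beta <= 1 `^ beta by rewrite ge0_ler_powR ?nnegrE ?(ltW beta_gt0).
by rewrite powR1 ger0_norm.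
Qed.

Let loss (w : Omega) (x : R) : R := local_average (sample X xi f w) x - g x.

Let lossE w x : loss w x =
  (\sum_(i < n) (g (X (e i) w) + xi (e i) w) * \1_(unit_ball x h) (X (e i) w))
    * `|n%:R * p x|^-1 - g x.
Proof.
rewrite /loss /local_average; congr (_ * _ - _); apply: eq_bigr => i _.
by rewrite tnth_mktuple/= gE//; exact: (covariate_unit model).
Qed.

Let measurable_loss :
  measurable_fun setT (fun z : Omega * measurableTypeR R => loss z.1 z.2).
Proof.
have -> : (fun z : Omega * measurableTypeR R => loss z.1 z.2) = (fun z =>
  (\sum_(i < n) (g (X (e i) z.1) + xi (e i) z.1)
     * \1_(unit_ball z.2 h) (X (e i) z.1))
    * `|n%:R * p z.2|^-1 - g z.2).
  by apply/funext => -[w x]; rewrite lossE.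
have mX i : measurable_fun setT
    (fun z : Omega * measurableTypeR R => X (e i) z.1 : measurableTypeR R).
  by apply: (measurableT_comp (measurable_funPT (X (e i)))).
apply: measurable_funB; last by apply: (measurableT_comp mg).
apply: measurable_funM; last first.
  apply: (measurableT_comp (@measurable_inv_normr R)); apply: measurable_funM => //.
  by apply: (measurableT_comp (measurable_measure_unit_ball M h)).
apply: measurable_sum => i; apply: measurable_funM.
  apply: measurable_funD; first exact: (measurableT_comp mg (mX i)).
  by apply: (measurableT_comp (measurable_funPT (xi (e i)))).
exact: measurable_indic_unit_ball.
Qed.

Let b := L * h `^ beta.

(** With [q = n%:R * p x], the loss is [q^-1] times a sum of [n] local responses, whose means are at
    most [b * p x] in absolute value and second moments at most [9 * sigma ^+ 2 * p x]. Dividing the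
    resulting bound by [q ^+ 2] leaves squared bias plus variance. *)
Let mean_squared_error x : x \in `[0, 1] ->
  (\int[Pr]_w (loss w x ^+ 2)%:E
    <= (b ^+ 2)%:E + (9 * sigma ^+ 2 / n%:R)%:E * (M (unit_ball x h))^-1)%E.
Proof.
move=> x01.
have mB := measurable_unit_ball x h.
have fM : M (unit_ball x h) \is a fin_num by exact: fin_num_measure.
have p0 : 0 <= p x by exact: fine_ge0.
have n0 : (0 : R) < n%:R by rewrite ltr0n.
(* A ball of mass 0 makes the right-hand side [+oo]. *)
rewrite -[M _]fineK// -/(p x) inver; case: eqP => [_|/eqP px0].
  by rewrite gt0_muley ?leey// lte_fin divr_gt0// mulr_gt0// exprn_gt0.
have {}p0 : 0 < p x by rewrite lt_def px0.
have ball01 y : unit_ball x h y -> y \in `[0, 1] by case.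
have gball y : unit_ball x h y -> `|g y| <= sigma.
  by move=> /ball01 y01; rewrite gE// f_le.
have gcball y : unit_ball x h y -> `|g y - g x| <= b.
  move=> [y01 xy]; rewrite !gE//; have [fL _] := f_holder.
  rewrite (le_trans (fL _ _ _ _))// ler_wpM2l ?(ltW L_gt0)//.
  by rewrite ge0_ler_powR ?nnegrE ?(ltW beta_gt0) ?(ltW h_gt0)// distrC.
have gx : `|g x| <= sigma by rewrite gE// f_le.
have KB y : unit_ball x h y -> (\int[K y]_t t%:E = 0)%E /\
    (\int[K y]_t (t ^+ 2)%:E <= (sigma ^+ 2)%:E)%E.
  by move=> /ball01; exact: K_adm.
have XE i : Pr (X (e i) @^-1` unit_ball x h) = M (unit_ball x h).
  by have := covariate_distribution model (e i) mB; rewrite law_e.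
have xiE i (B : set (measurableTypeR R)) : measurable B ->
    (Pr (X (e i) @^-1` unit_ball x h `&` xi (e i) @^-1` B)
      = \int[M]_(y in unit_ball x h) K y B)%E.
  by move=> mB'; rewrite (noise_conditional_law model)// law_e.
pose V i : Omega -> measurableTypeR R :=
  local_response M (X (e i)) (xi (e i)) (unit_ball x h) g (g x).
have mV i : measurable_fun setT (V i) by exact: measurable_local_response.
(* Every [V i] is the same measurable function [phi] of the pair [(X (e i), xi (e i))], so
   independence of the pairs passes to the [V i]. *)
pose phi (z : measurableTypeR R * measurableTypeR R) : measurableTypeR R :=
  (g z.1 + z.2) * \1_(unit_ball x h) z.1 - g x * p x.
have mphi : measurable_fun setT phi.
  apply: measurable_funB => //; apply: measurable_funM.
    by apply: measurable_funD => //; apply: (measurableT_comp mg).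
  by apply: (measurableT_comp (f := \1_(unit_ball x h) : measurableTypeR R -> R)).
have mean i := integral_local_response mB (XE i) (xiE i) KB mg gcball.
have sqr i := integral_local_response_sqr mB (XE i) (xiE i) KB mg gball gx.
have sum_sqr := @integral_sum_sqr_le _ _ _ Pr n V (b * p x)
  (9 * sigma ^+ 2 * p x) mV mean sqr.
have indV i j : i != j -> forall A B : set (measurableTypeR R),
    measurable A -> measurable B ->
    (Pr (V i @^-1` A `&` V j @^-1` B)
      = Pr (V i @^-1` A) * Pr (V j @^-1` B))%E.
  move=> ij A B mA mB'.
  have mphi' (C : set (measurableTypeR R)) : measurable C -> measurable (phi @^-1` C).
    by move=> mC; rewrite -[X in measurable X]setTI; exact: mphi.
  apply: (mutually_independent_pair (sample_independent model) (i := e i) (j := e j)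
    (A := phi @^-1` A) (B := phi @^-1` B)); rewrite ?(inj_eq e_inj)//; exact: mphi'.
have {}sum_sqr := sum_sqr indV.
pose q := n%:R * p x.
have q0 : 0 < q by rewrite mulr_gt0.
have lossV w : ((loss w x ^+ 2)%:E = (q ^- 2)%:E * ((\sum_i V i w) ^+ 2)%:E)%E.
  rewrite -EFinM; congr EFin; rewrite lossE -/q.
  have -> : \sum_i V i w = \sum_(i < n)
     (g (X (e i) w) + xi (e i) w) * \1_(unit_ball x h) (X (e i) w)
     - q * g x.
    rewrite /V/= /local_response sumrB sumr_const card_ord -mulr_natl.
    by congr (_ - _); rewrite -/(p x) /q; ring.
  by rewrite gtr0_norm//; field; rewrite gt_eqF.
under eq_integral do rewrite lossV.
rewrite ge0_integralZl//; last 3 first.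
- apply/measurable_EFinP; apply: measurable_funX; exact: measurable_sum.
- by move=> w _; rewrite lee_fin sqr_ge0.
- by rewrite lee_fin invr_ge0 sqr_ge0.
apply: (@le_trans _ _ ((q ^- 2)%:E
    * ((n%:R * (b * p x)) ^+ 2 + n%:R * (9 * sigma ^+ 2 * p x))%:E)%E).
  by rewrite lee_pmul2l// lte_fin invr_gt0 exprn_gt0.
rewrite -EFinM -EFinM -EFinD lee_fin le_eqVlt; apply/orP; left; apply/eqP.
by rewrite /q; field; rewrite !gt_eqF.
Qed.

(** Tonelli turns the risk into the [Q]-integral of the pointwise mean squared error. The squared
    bias is constant and [Q] has mass at most 1 on [0, 1]; the variance term integrates to a
    multiple of [rho h M Q]. *)
Lemma risk_local_average :
  (risk Q X xi local_average f <= ((L * h `^ beta) ^+ 2)%:E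
    + (9 * sigma ^+ 2 / n%:R)%:E * rho h M Q)%E.
Proof.
have n0 : (0 : R) < n%:R by rewrite ltr0n.
have mI : measurable (`[0%R, 1%R]%classic : set (measurableTypeR R)).
  exact: measurable_itv.
(* The indicator moves the domain [0, 1] into the integrand, so that Tonelli applies on the full
   product space. *)
pose F (z : Omega * measurableTypeR R) : \bar R :=
  (loss z.1 z.2 ^+ 2 * \1_(`[0%R, 1%R]%classic) z.2)%:E.
have mF : measurable_fun setT F.
  apply/measurable_EFinP; apply: measurable_funM; first exact: measurable_funX.
  by apply: (measurableT_comp (f := \1_(`[0%R, 1%R]%classic) : measurableTypeR R -> R)).
have F0 z : (0 <= F z)%E by rewrite lee_fin mulr_ge0 ?sqr_ge0.
have riskE : (risk Q X xi local_average f = \int[Pr]_w \int[Q]_x F (w, x))%E.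
  apply: eq_integral => w _; rewrite /L2_norm_sq integral_mkcond.
  apply: eq_integral => x _; rewrite patchE /F indicE /=.
  case: ifPn => [/[!inE] x01|_]; last by rewrite mulr0.
  by rewrite mulr1 /loss gE.
rewrite riskE (fubini_tonelli F)//.
have -> : (\int[Q]_x \int[Pr]_w F (w, x)
    = \int[Q]_(x in `[0%R, 1%R]) \int[Pr]_w (loss w x ^+ 2)%:E)%E.
  rewrite [RHS]integral_mkcond; apply: eq_integral => x _.
  rewrite patchE; case: ifPn => x01.
    by apply: eq_integral => w _; rewrite /F indicE x01 mulr1.
  by rewrite integral0_eq// => w _; rewrite /F indicE (negbTE x01) mulr0.
have minv := measurable_inve_measure_unit_ball M h.
have inv0 x : (0 <= (M (unit_ball x h))^-1)%E by rewrite inve_ge0.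
apply: (@le_trans _ _ (\int[Q]_(x in `[0%R, 1%R])
    ((b ^+ 2)%:E + (9 * sigma ^+ 2 / n%:R)%:E * (M (unit_ball x h))^-1))%E).
  apply: ge0_le_integral => //.
  - by move=> x _; apply: integral_ge0 => w _; rewrite lee_fin sqr_ge0.
  - apply: measurable_funTS.
    apply: (measurable_fun_fubini_tonelli_G
      (fun z : Omega * measurableTypeR R => (loss z.1 z.2 ^+ 2)%:E)).
      by apply/measurable_EFinP; exact: measurable_funX.
    by move=> z; rewrite lee_fin sqr_ge0.
  - apply: measurable_funTS; apply: emeasurable_funD => //.
    exact: measurable_funeM.
have c0 : (0 <= (9 * sigma ^+ 2 / n%:R)%:E)%E.
  by rewrite lee_fin divr_ge0 ?mulr_ge0 ?sqr_ge0// ltW.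
rewrite ge0_integralD//; last 3 first.
- by move=> x _; rewrite lee_fin sqr_ge0.
- by move=> x _; rewrite mule_ge0.
- by apply: measurable_funTS; exact: measurable_funeM.
rewrite ge0_integralZl//; last exact: measurable_funTS.
rewrite leeD2r// integral_cst// -[leRHS]mule1 lee_wpmul2l ?lee_fin ?sqr_ge0//.
exact: probability_le1.
Qed.

End SubsampleRisk.

(** A ball of radius [h] contains every cell [I k] in which its centre lies, so the integrand is at
    most [(Q (I k))^-1] on that cell, and each cell contributes at most 1 to the integral. *)
Lemma rho_diag_le {R : realType} (Q : probability (measurableTypeR R) R) (h : R) :
  0 < h -> h <= 1 -> (rho h Q Q <= (2 / h)%:E)%E.
Proof.
(* The added 1 lets the cells reach the endpoint 1; the count stays below [2 / h] because
   [1 <= h^-1]. *)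
move=> h0 h1; pose N := (Num.truncn h^-1).+1.
have NE : (N%:R : R) <= 2 / h.
  have := truncn_le h^-1; rewrite invr_ge0 (ltW h0) => hN.
  have : 1 <= h^-1 by rewrite invf_ge1.
  by rewrite /N -natr1; lra.
pose I (k : nat) : set (measurableTypeR R) :=
  `[k%:R * h, k.+1%:R * h]%classic `&` `[0%R, 1%R]%classic.
have mI k : measurable (I k) by apply: measurableI; exact: measurable_itv.
have mI01 : measurable (`[0%R, 1%R]%classic : set (measurableTypeR R)).
  exact: measurable_itv.
have minv := measurable_inve_measure_unit_ball Q h.
have inv0 k : (0 <= (Q (I k))^-1)%E by rewrite inve_ge0.
pose F (x : measurableTypeR R) : \bar R :=
  (\sum_(k < N) (Q (I k))^-1 * (\1_(I k) x)%:E)%E.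
have m1 k : measurable_fun (`[0%R, 1%R]%classic : set (measurableTypeR R))
    (fun x => (\1_(I k) x)%:E : \bar R).
  by apply/measurable_EFinP; exact: measurable_indic.
apply: (@le_trans _ _ (\int[Q]_(x in `[0%R, 1%R]) F x)%E).
  apply: ge0_le_integral => //.
  - by move=> x _; rewrite inve_ge0.
  - exact: measurable_funTS.
  - apply: emeasurable_sum => k; exact: measurable_funeM.
  - move=> x x01; pose k := Num.truncn (x / h).
    move: (x01); rewrite /= in_itv/= => /andP[x0 x1].
    have xh0 : 0 <= x / h by rewrite divr_ge0// ltW.
    have /andP[kx xk] := truncn_itv xh0.
    have kN : (k < N)%N.
      by rewrite ltnS le_truncn// ler_piMl ?invr_ge0// ltW.
    have xI : I k x.
      split => //=; rewrite in_itv/=; apply/andP; split.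
        by rewrite -ler_pdivlMr.
      by rewrite -ler_pdivrMr// ltW.
    have IB : I k `<=` unit_ball x h.
      move=> y [/= yk y01]; split => //; move: yk xI => + [/= + _].
      rewrite !in_itv/= -natr1 !mulrDl mul1r => /andP[? ?] /andP[? ?].
      by rewrite ler_norml; apply/andP; split; lra.
    rewrite /F (bigD1 (Ordinal kN))//=.
    rewrite indicE mem_set// mule1 -[leLHS]adde0 leeD//.
      have : (Q (I k) <= Q (unit_ball x h))%E.
        by rewrite le_measure ?inE//; exact: measurable_unit_ball.
      have fI : Q (I k) \is a fin_num by exact: fin_num_measure.
      have fB : Q (unit_ball x h) \is a fin_num.
        by apply: fin_num_measure; exact: measurable_unit_ball.
      have : (0 <= Q (I k))%E by [].
      rewrite -(fineK fI) -(fineK fB) !lee_fin !inver => I0 IB'.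
      (* The extended inverse is antitone, with 0 treated apart: a null ball forces a null cell. *)
      case: ifPn => [/eqP B0|Bn0]; case: ifPn => [/eqP Ik0|In0]; rewrite ?leey//.
        by move: In0; rewrite eq_le I0 andbT -B0 IB'.
      by rewrite lee_fin lef_pV2// posrE lt_def ?In0 ?Bn0//= (le_trans I0).
    by apply: sume_ge0 => j _; rewrite mule_ge0// lee_fin.
rewrite /F ge0_integral_sum//; last 2 first.
- by move=> k; exact: measurable_funeM.
- by move=> k x _; rewrite mule_ge0// lee_fin.
apply: (@le_trans _ _ (\sum_(k < N) 1)%E); last first.
  by rewrite sumEFin lee_fin sumr_const card_ord.
apply: lee_sum => k _; rewrite ge0_integralZl//.
rewrite integral_indic// setIidl; last by move=> x [].
(* This is only an inequality: a null cell gives [+oo * 0 = 0]. *)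
have inv_mul_le1 (q : \bar R) : q \is a fin_num -> (q^-1 * q <= 1)%E.
  case: q => [r _|//|//]; rewrite inver; case: eqVneq => [->|r0].
    by rewrite mule0.
  by rewrite -EFinM mulVf.
by apply: inv_mul_le1; exact: fin_num_measure.
Qed.

(** Here [x + y <= 2 * y], and 2^k is at most 2 for [k <= 1]. This replaces the dominant term of the
    rate by the sum of both terms, at the cost of a factor 2. *)
Lemma powR_max_le_sum {R : realType} (x y k : R) :
  0 <= x -> x <= y -> 0 < y -> 0 <= k -> k <= 1 ->
  y `^ (- k) <= 2 * (x + y) `^ (- k).
Proof.
move=> x0 xy y0 k0 k1.
have s0 : 0 < x + y by rewrite ltr_wpDl.
rewrite !powRN -ler_pdivrMl// -invfM lef_pV2 ?posrE ?mulr_gt0 ?powR_gt0//.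
apply: (@le_trans _ _ ((2 * y) `^ k)).
  by rewrite ge0_ler_powR ?nnegrE//; lra.
rewrite powRM ?(ltW y0)// ler_wpM2r ?powR_ge0//.
by rewrite ler1_powR//; lra.
Qed.

(** * Choice of the bandwidth *)

Section MinimaxRate.
Context (R : realType) (beta L sigma : R).
Hypothesis beta_gt0 : 0 < beta.
Hypothesis L_gt0 : 0 < L.
Hypothesis L_le : L <= sigma.
Context (d : measure_display) (Omega : measurableType d).
Variables (Pr : probability Omega R) (P Q : probability (measurableTypeR R) R).
Variables (nP nQ : nat).
Variable K : R.-pker (measurableTypeR R) ~> (measurableTypeR R).
Hypothesis K_adm : admissible_noise sigma K.
Variables X xi : 'I_(nP + nQ) -> {RV Pr >-> measurableTypeR R}.
Hypothesis model : observation_model P Q K X xi.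

(** With t = n / sigma^2, the bandwidth h = t^(-1 / (2 beta + gamma)) equates h^(2 beta) and
    h^(-gamma) / t, and both become the stated rate. The exponent [gamma] is left free to take the
    values [alpha], 1 and 0. *)
Lemma minimax_risk_subsample (n : nat) (e : 'I_n -> 'I_(nP + nQ))
    (M : probability (measurableTypeR R) R) (gamma D : R) :
  injective e -> (forall i, covariate_law P Q (e i) = M) ->
  0 <= gamma -> 0 <= D ->
  (forall h, 0 < h -> h <= 1 -> (rho h M Q <= (D * h `^ (- gamma))%:E)%E) ->
  1 <= n%:R / sigma ^+ 2 ->
  (minimax_risk Q beta L X xi <= ((L ^+ 2 + 9 * D)
    * (n%:R / sigma ^+ 2) `^ (- (2 * beta / (2 * beta + gamma))))%:E)%E.
Proof.
move=> e_inj law_e gamma0 D0 rho_le; set t := n%:R / sigma ^+ 2 => t1.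
have t0 : 0 < t by exact: lt_le_trans t1.
have s0 : 0 < sigma by exact: lt_le_trans L_le.
have n0 : (0 < n)%N.
  rewrite lt0n; apply/negP => /eqP n0.
  by move: t0; rewrite /t n0 mul0r ltxx.
have bg0 : 0 < 2 * beta + gamma by rewrite ltr_wpDr// mulr_gt0.
pose h := t `^ (- (2 * beta + gamma)^-1).
have h0 : 0 < h by exact: powR_gt0.
(* [t1] keeps the bandwidth in the range where [rho_le] applies. *)
have h1 : h <= 1.
  rewrite /h powRN invf_le1 ?powR_gt0//.
  by have := ler_powR t1 (_ : 0 <= (2 * beta + gamma)^-1); rewrite powRr0;
    apply; rewrite invr_ge0 ltW.
have hbE : (L * h `^ beta) ^+ 2 = L ^+ 2 * t `^ (- (2 * beta / (2 * beta + gamma))).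
  rewrite exprMn -(powR_mulrn 2 (powR_ge0 h beta)) /h -!powRrM.
  congr (_ * _ `^ _).
  by field; rewrite gt_eqF.
have hgE : 9 * sigma ^+ 2 / n%:R * (D * h `^ (- gamma))
    = 9 * D * t `^ (- (2 * beta / (2 * beta + gamma))).
  have -> : 9 * sigma ^+ 2 / n%:R = 9 * t^-1.
    by rewrite /t; field; rewrite (gt_eqF s0) pnatr_eq0 -lt0n n0.
  rewrite mulrACA; congr (_ * _).
  rewrite -powR_inv1 ?(ltW t0)// -powRrM -powRD; last first.
    by rewrite (gt_eqF t0) implybT.
  by congr (_ `^ _); field; rewrite gt_eqF.
apply: (@le_trans _ _ (ereal_sup [set risk Q X xi
    (local_average e M h) f | f in holder_class beta L])).
  apply: ereal_inf_lbound; exists (local_average e M h) => //.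
  exact: local_average_estimator.
apply: ge_ereal_sup => _ [f fH <-].
apply: (le_trans (risk_local_average beta_gt0 L_gt0 L_le K_adm model n0 e_inj
  law_e h0 fH)).
rewrite [X in (_ <= X%:E)%E]mulrDl -hbE -hgE EFinD leeD2l// [leRHS]EFinM.
apply: lee_wpmul2l; last exact: rho_le.
by rewrite lee_fin divr_ge0// mulr_ge0// sqr_ge0.
Qed.

End MinimaxRate.

Lemma classD_rho_le {R : realType} (alpha C : R)
    (P Q : probability (measurableTypeR R) R) (h : R) :
  classD alpha C P Q -> 0 < h -> h <= 1 ->
  (rho h P Q <= (C * h `^ (- alpha))%:E)%E.
Proof.
move=> PQ h0 h1.
rewrite powRN mulrC EFinM lee_pdivlMl ?powR_gt0//.
apply: le_trans PQ; apply: ereal_sup_ubound; exists h => //=.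
by rewrite in_itv/= h0.
Qed.

(** * Combination of the two samples *)

Theorem corollary1 (R : realType) (L beta alpha C : R)
    (hL : 0 < L) (hbeta0 : 0 < beta) (hbeta1 : beta <= 1)
    (halpha : 0 < alpha) (hC : 1 <= C) :
  exists2 cu : R, 0 < cu &
  forall sigma : R, L <= sigma ->
  exists nu : nat,
  forall nP nQ : nat, (nu <= maxn nP nQ)%N ->
  forall K : R.-pker (measurableTypeR R) ~> (measurableTypeR R),
  admissible_noise sigma K ->
  forall P Q : probability (measurableTypeR R) R,
  on_unit_interval P -> on_unit_interval Q ->
  forall (d : measure_display) (Omega : measurableType d)
    (Pr : probability Omega R)
    (X xi : 'I_(nP + nQ) -> {RV Pr >-> measurableTypeR R}),
  observation_model P Q K X xi ->
  (1 <= alpha -> classD alpha C P Q ->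
    (minimax_risk Q beta L X xi <=
      (cu * ((nP%:R / sigma ^+ 2) `^ ((2 * beta + 1) / (2 * beta + alpha))
             + nQ%:R / sigma ^+ 2) `^ (- (2 * beta / (2 * beta + 1))))%:E)%E)
  /\
  (alpha <= 1 -> classD' alpha C P Q ->
    (minimax_risk Q beta L X xi <=
      (cu * ((nP%:R / sigma ^+ 2) `^ (2 * beta / (2 * beta + alpha))
             + nQ%:R / sigma ^+ 2)^-1)%:E)%E).
Proof.
(* Since [1 <= C], [c0] dominates both [L ^+ 2 + 9 * C] and [L ^+ 2 + 9 * 2], the constants that
   come with the bounds [C] and 2 on the similarity. *)
pose c0 := L ^+ 2 + 18 * C.
have C0 : 0 < C by exact: lt_le_trans hC.
have c00 : 0 < c0 by rewrite ltr_wpDl ?sqr_ge0// mulr_gt0.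
have c0P : L ^+ 2 + 9 * C <= c0 by rewrite /c0; lra.
have c0Q : L ^+ 2 + 9 * 2 <= c0 by rewrite /c0; lra.
exists (2 * c0); first exact: mulr_gt0.
(* The threshold is the least integer above [sigma ^+ 2], so the larger sample has at least
   [sigma ^+ 2] points. *)
move=> sigma Ls; exists (Num.truncn (sigma ^+ 2)).+1 => nP nQ hn K Kadm P Q P01 Q01
  d Omega Pr X xi model.
have s0 : 0 < sigma by exact: lt_le_trans Ls.
have s20 : 0 < sigma ^+ 2 by exact: exprn_gt0.
set a := nP%:R / sigma ^+ 2; set q := nQ%:R / sigma ^+ 2.
have a0 : 0 <= a by rewrite divr_ge0// ltW.
have q0 : 0 <= q by rewrite divr_ge0// ltW.
have ge1 (m : nat) : ((Num.truncn (sigma ^+ 2)).+1 <= m)%N -> 1 <= m%:R / sigma ^+ 2.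
  move=> nm; rewrite ler_pdivlMr// mul1r.
  have /andP[_ /ltW/le_trans] := truncn_itv (ltW s20).
  by apply; rewrite ler_nat.
have aq : 1 <= a \/ 1 <= q.
  by move: hn; rewrite leq_max => /orP[]/ge1; [left|right].
(* A positive power does not move a number across 1. As [a] or [q] is at least 1, the larger of the
   two rate terms comes from a sample to which the bandwidth choice applies. *)
have dominant_ge1 r : 0 < r -> (q <= a `^ r -> 1 <= a) /\ (a `^ r < q -> 1 <= q).
  move=> r0; split => [qA|Aq].
    case: aq => // q1; rewrite leNgt; apply/negP => a1.
    have : a `^ r < 1 `^ r by rewrite gt0_ltr_powR ?nnegrE.
    by rewrite powR1; lra.
  case: aq => // a1; apply: ltW; apply: le_lt_trans Aq.
  have : 1 `^ r <= a `^ r by rewrite ge0_ler_powR ?nnegrE// ltW.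
  by rewrite powR1.
have b20 : 0 < 2 * beta by rewrite mulr_gt0.
have finish (k x y D : R) : 0 <= k -> k <= 1 -> 0 <= x -> x <= y -> 0 < y ->
    D <= c0 -> D * y `^ (- k) <= 2 * c0 * (x + y) `^ (- k).
  move=> k0 k1 x0 xy y0 Dc.
  apply: (@le_trans _ _ (c0 * y `^ (- k))); first by rewrite ler_wpM2r ?powR_ge0.
  by rewrite [2 * _]mulrC -mulrA ler_wpM2l ?powR_max_le_sum// ltW.
have riskP : classD alpha C P Q -> 1 <= a -> (minimax_risk Q beta L X xi <=
    ((L ^+ 2 + 9 * C) * a `^ (- (2 * beta / (2 * beta + alpha))))%:E)%E.
  move=> PQ a1.
  apply: (minimax_risk_subsample hbeta0 hL Ls Kadm model (e := lshift nQ) (M := P)) => //.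
  - exact: lshift_inj.
  - by move=> i; rewrite /covariate_law /= ltn_ord.
  - exact: ltW.
  - exact: ltW.
  - by move=> h h0 h1; exact: classD_rho_le.
(* Case (a) takes [gamma = 1] and [D = 2] from the covering bound; case (b) takes [gamma = 0] and
   [D = C] from the class. *)
have riskQ gamma D : 0 <= gamma -> 0 <= D ->
    (forall h, 0 < h -> h <= 1 -> (rho h Q Q <= (D * h `^ (- gamma))%:E)%E) ->
    1 <= q -> (minimax_risk Q beta L X xi <=
    ((L ^+ 2 + 9 * D) * q `^ (- (2 * beta / (2 * beta + gamma))))%:E)%E.
  move=> gamma0 D0 QQ q1.
  apply: (minimax_risk_subsample hbeta0 hL Ls Kadm model (e := @rshift nP nQ) (M := Q)) => //.
    exact: rshift_inj.
  by move=> i; rewrite /covariate_law /= ltnNge leq_addr.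
split => [alpha1 PQ|alpha1 [PQ QQ]].
(* The power [r] converts the P-sample into an equivalent Q-sample size: raising the result to the
   common exponent of case (a) gives back the P-rate. *)
- pose r := (2 * beta + 1) / (2 * beta + alpha).
  have r0 : 0 < r by rewrite divr_gt0// addr_gt0.
  have [Aq1 qA1] := dominant_ge1 r r0.
  have k0 : 0 <= 2 * beta / (2 * beta + 1) by rewrite divr_ge0// ltW// addr_gt0.
  have k1 : 2 * beta / (2 * beta + 1) <= 1.
    by rewrite ler_pdivrMr ?mul1r ?addr_gt0// lerDl.
  have [qA|Aq] := leP q (a `^ r).
    have a1 := Aq1 qA.
    apply: (le_trans (riskP PQ a1)); rewrite lee_fin [_ + q]addrC.
    have -> : a `^ (- (2 * beta / (2 * beta + alpha)))
        = (a `^ r) `^ (- (2 * beta / (2 * beta + 1))).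
      rewrite -powRrM /r; congr (_ `^ _); field.
      by rewrite !gt_eqF ?addr_gt0.
    by apply: finish => //; apply: powR_gt0; lra.
  have q1 := qA1 Aq.
  apply: (@le_trans _ _ ((L ^+ 2 + 9 * 2)
      * q `^ (- (2 * beta / (2 * beta + 1))))%:E).
    apply: riskQ => // h h0 h1.
    by rewrite powR_inv1 ?(ltW h0)//; exact: rho_diag_le.
  by rewrite lee_fin; apply: finish => //; [exact: powR_ge0|exact: ltW|lra].
- pose r := 2 * beta / (2 * beta + alpha).
  have r0 : 0 < r by rewrite divr_gt0// addr_gt0.
  have [Aq1 qA1] := dominant_ge1 r r0.
  rewrite -/r -powR_inv1; last by rewrite addr_ge0// powR_ge0.
  have [qA|Aq] := leP q (a `^ r).
    have a1 := Aq1 qA.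
    apply: (le_trans (riskP PQ a1)); rewrite lee_fin [_ + q]addrC.
    have -> : a `^ (- (2 * beta / (2 * beta + alpha))) = (a `^ r) `^ (- 1).
      by rewrite -powRrM mulrN mulr1.
    by apply: finish => //; apply: powR_gt0; lra.
  have q1 := qA1 Aq.
  apply: (@le_trans _ _ ((L ^+ 2 + 9 * C) * q `^ (- 1))%:E).
    (* A similarity bound uniform in [h] corresponds to [gamma = 0], for which the rate exponent is
       [-1]. *)
    have -> : (-1 : R) = - (2 * beta / (2 * beta + 0)).
      by rewrite addr0 divff// gt_eqF.
    apply: riskQ => //; first exact: ltW.
    move=> h h0 h1; rewrite oppr0 powRr0 mulr1.
    apply: le_trans QQ; apply: ereal_sup_ubound; exists h => //=.
    by rewrite in_itv/= h0.
  by rewrite lee_fin; apply: finish => //; [exact: powR_ge0|exact: ltW|lra].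
Qed.
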